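(* Let $G=(V,E)$ be a finite, simple, connected, undirected graph with $n\ge 2$ nodes, and let $t$ be an integer with $0\le t<\kappa(G)$. Then no oblivious algorithm solves consensus in $G$ under the $t$-resilient model (i.e. for all input assignments and all failure patterns in $\Phi^{(t)}_{\mathrm{all}}$) in fewer than $\mathrm{radius}(G,t)$ rounds.
   Context: Model. $G=(V,E)$ is a finite simple connected undirected graph whose nodes carry distinct identifiers; $N(v)$ denotes the neighbourhood of $v$ and $\kappa(G)$ the vertex connectivity of $G$ (minimum number of nodes whose removal disconnects $G$ or leaves a single node). Computation proceeds in synchronous rounds $1,2,\dots$: in each round every node sends a message to each neighbour, receives the messages of its neighbours, and computes. Every node knows $G$ and $t$ in advance. Failure patterns. For an integer $t\ge 0$, a failure pattern is a set $\varphi=\{(v,F_v,f_v): v\in F\}$ with $F\subseteq V$, $|F|\le t$, and for each $v\in F$ an integer $f_v\ge 1$ and a nonempty set $F_v\subseteq N(v)$: node $v$ behaves normally in rounds $1,\dots,f_v-1$, in round $f_v$ its messages reach exactly the neighbours in $N(v)\setminus F_v$, and afterwards it sends nothing. Nodes of $F$ are faulty, nodes of $V\setminus F$ are correct in $\varphi$. $\Phi^{(t)}_{\mathrm{all}}$ is the set of all failure patterns with at most $t$ faulty nodes. Causal paths and eccentricity. A causal path w.r.t. $\varphi$ from $v$ to $v'$ is a sequence $u_1=v,u_2,\dots,u_q=v'$ with $u_{i+1}\in N(u_i)$ such that for each $i<q$, $u_i$ has not crashed during rounds $1,\dots,i-1$, and if $u_i$ crashes at round $i$ (i.e. $(u_i,F_{u_i},i)\in\varphi$)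 then $u_{i+1}\notin F_{u_i}$; its length is $q-1$. $\mathrm{ecc}(v,\varphi)$ is the maximum, over all correct nodes $v'$ of $\varphi$, of the minimum length of a causal path w.r.t. $\varphi$ from $v$ to $v'$ (this is $\infty$ if some correct node has no such path). Let $\Phi^\star_v=\{\varphi\in\Phi^{(t)}_{\mathrm{all}}:\mathrm{ecc}(v,\varphi)<\infty\}$ and $\mathrm{radius}(G,t)=\min_{v\in V}\max_{\varphi\in\Phi^\star_v}\mathrm{ecc}(v,\varphi)$. Views and oblivious algorithms. Each node $u$ has an input $x_u$; in the flooding protocol every node sends $(u,x_u)$ in round 1 and in each later round forwards all pairs it knows. $\mathrm{view}(v,r,\varphi)$ is the set of pairs $(u,x_u)$ known to $v$ after $r$ rounds under $\varphi$; $(u,x_u)\in \mathrm{view}(v,r,\varphi)$ iff $u=v$ or there is a causal path w.r.t. $\varphi$ from $u$ to $v$ of length at most $r$. An oblivious algorithm running in $r$ rounds performs this flooding for $r$ rounds, after which each correct node $v$ outputs a value depending only on $v$ and the set $\mathrm{view}(v,r,\varphi)$. Consensus. Inputs are taken from a set $I$ with $|I|\ge2$; every correct node $v$ must output $y_v\in I$ such that all correct nodes output the same value (agreement) and each output equals $x_u$ for some node $u$ (validity). *)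

(* Defs.v *)
From mathcomp Require Import all_boot.
From Stdlib Require Import ClassicalEpsilon.

Set Implicit Arguments.
Unset Strict Implicit.
Unset Printing Implicit Defensive.

Section Defs.

Variable T : finType.
(* the graph G = (V,E): V = T, E given by a symmetric irreflexive relation e *)
Variable e : rel T.

Definition nbhd (v : T) : {set T} := [set w | e v w].

Definition induced_rel (S : {set T}) : rel T :=
  [rel x y | [&& x \notin S, y \notin S & e x y]].

Definition separating (S : {set T}) : bool :=
  (#|~: S| <= 1) ||
  ~~ [forall x in ~: S, forall y in ~: S, connect (induced_rel S) x y].

(* minimum size of such a set (setT is always separating, so this is a
   true minimum) *)
Definition kappa : nat := \big[minn/#|T|]_(S : {set T} | separating S) #|S|.

(* pfaulty = F, pset v = F_v, pround v = f_v ; the last two are only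
   meaningful for v \in F *)
Record pattern := Pattern {
  pfaulty : {set T};
  pset : T -> {set T};
  pround : T -> nat }.

Definition valid_pattern (t : nat) (phi : pattern) : Prop :=
  #|pfaulty phi| <= t /\
  forall v, v \in pfaulty phi ->
    [/\ 1 <= pround phi v, pset phi v != set0 & pset phi v \subset nbhd v].

(* cpath phi r u s : the sequence u :: s is a causal path, where u is its
   r-th node (1-indexed), i.e. u sends along the next edge in round r. *)
Fixpoint cpath (phi : pattern) (r : nat) (u : T) (s : seq T) : bool :=
  match s with
  | [::] => true
  | w :: s' =>
    [&& e u w,
        ~~ ((u \in pfaulty phi) && (pround phi u < r)),      (* not crashed in rounds 1..r-1 *)
        ((u \in pfaulty phi) && (pround phi u == r)) ==> (w \notin pset phi u)
      & cpath phi r.+1 w s']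
  end.

Definition path_within (phi : pattern) (u v : T) (r : nat) : bool :=
  [exists k : 'I_r.+1, [exists s : k.-tuple T,
     cpath phi 1 u s && (last u s == v)]].

Definition pb (P : Prop) : bool :=
  if excluded_middle_informative P then true else false.

Definition ecc_le (phi : pattern) (v : T) (r : nat) : bool :=
  [forall w, (w \notin pfaulty phi) ==> path_within phi v w r].

Definition ecc_finite (phi : pattern) (v : T) : Prop := exists r, ecc_le phi v r.

(* ecc(v,phi) when finite (value 0 is a dummy for the infinite case, which
   is never used below) *)
Definition ecc (phi : pattern) (v : T) : nat :=
  match excluded_middle_informative (ecc_finite phi v) with
  | left H => ex_minn H
  | right _ => 0
  end.

Definition in_Phi_star (t : nat) (v : T) (phi : pattern) : Prop :=
  valid_pattern t phi /\ ecc_finite phi v.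

(* max_{phi in Phi*_v} ecc(v,phi), as the least upper bound in nat;
   None = infinite (unbounded) *)
Definition max_ecc (t : nat) (v : T) : option nat :=
  match excluded_middle_informative
          (exists B, pb (forall phi, in_Phi_star t v phi -> ecc phi v <= B)) with
  | left H => Some (ex_minn H)
  | right _ => None
  end.

(* radius(G,t) = min_v max_{phi in Phi*_v} ecc(v,phi); None = infinite *)
Definition radius (t : nat) : option nat :=
  match excluded_middle_informative
          (exists R, [exists v, max_ecc t v == Some R]) with
  | left H => Some (ex_minn H)
  | right _ => None
  end.

Definition lt_radius (r : nat) (R : option nat) : bool :=
  if R is Some R' then r < R' else true.

Variable I : Type.

(* view(v,r,phi) for the input assignment x, encoded as the partial function
   u |-> Some (x u) if (u, x u) is in the view, None otherwise *)
Definition view (phi : pattern) (x : T -> I) (v : T) (r : nat)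
  : {ffun T -> option I} :=
  [ffun u => if (u == v) || path_within phi u v r then Some (x u) else None].

Definition oblivious_solves_consensus (t r : nat)
  (out : T -> {ffun T -> option I} -> I) : Prop :=
  forall (x : T -> I) (phi : pattern), valid_pattern t phi ->
    (forall v w, v \notin pfaulty phi -> w \notin pfaulty phi ->
       out v (view phi x v r) = out w (view phi x w r)) /\
    (forall v, v \notin pfaulty phi -> exists u, out v (view phi x v r) = x u).

End Defs.

(* Main.v *)
Require Import Defs.
From mathcomp Require Import all_boot.
From Stdlib Require Import ClassicalEpsilon.
From mathcomp Require Import zify.

Set Implicit Arguments.
Unset Strict Implicit.
Unset Printing Implicit Defensive.

(** A configuration [(f, S)] lets [u] crash in round [f u], losing its messages
    to [S u]; [f u = r.+1] means that [u] is correct during the [r] rounds. If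
    [r] is less than the radius, every node [v] has a pattern in which, after
    [r] rounds, some correct node [w] has not heard from [v] but some other
    correct node has. Choose it with crashes as late as possible. Then each
    crashing [u] has a relay: a neighbour that has heard from [v] by the round
    in which [u] crashes and that survives this round.

    From such a pattern all crashes can be postponed beyond round [r], starting
    with the latest ones, without changing the decision. Whether [u] informs its
    relay is not noticed by [w], provided the other crashes are temporarily moved
    back as early as possible. Once the relay, with its own crash temporarily
    removed, is informed, it does not notice whether [u] informs its other
    neighbours. So the decision is the one of the failure-free execution, and
    since [w] has not heard from [v] it does not depend on the input of [v].
    As [v] is arbitrary, the decision is constant, contradicting validity. *)

(** * Flooding described by crash rounds and lost messages *)

Section Flooding.

Variables (T : finType) (e : rel T).
Implicit Types (f g : T -> nat) (S : T -> {set T}) (phi : pattern T).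

Definition delivers f S i u x :=
  [&& e u x, i <= f u & (i == f u) ==> (x \notin S u)].

Fixpoint reach f S v i : {set T} :=
  if i is j.+1 then
    reach f S v j :|: [set x | [exists u in reach f S v j, delivers f S j.+1 u x]]
  else [set v].

Lemma reach_step f S v i u x :
  u \in reach f S v i -> delivers f S i.+1 u x -> x \in reach f S v i.+1.
Proof.
move=> hu hd; rewrite /= !inE; apply/orP; right.
by apply/existsP; exists u; rewrite hu.
Qed.

Lemma reachS f S v i x : x \in reach f S v i.+1 ->
  x \in reach f S v i \/
  exists2 u, u \in reach f S v i & delivers f S i.+1 u x.
Proof.
rewrite /= !inE => /orP[->|/existsP[u /andP[hu hd]]]; first by left.
by right; exists u.
Qed.

Lemma reach_mono f S v i j : i <= j -> reach f S v i \subset reach f S v j.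
Proof.
elim: j => [|j IH]; first by rewrite leqn0 => /eqP->.
rewrite leq_eqVlt => /orP[/eqP->//|/IH h].
by apply: subset_trans h _; apply: subsetUl.
Qed.

#[global] Arguments reach : simpl never.

Lemma reach_monoP f S v i j x :
  i <= j -> x \in reach f S v i -> x \in reach f S v j.
Proof. by move=> ij; apply: (subsetP (reach_mono _ _ _ ij)). Qed.

(** Induction principle for upper bounds: [B] need only be closed under messages whose sender lies
    both in [B i] and in the reached set. *)
Lemma reach_min f S v k (B : nat -> {set T}) :
  v \in B 0 ->
  (forall i, i < k -> {subset B i <= B i.+1}) ->
  (forall i q x, i < k -> q \in B i -> q \in reach f S v i ->
     delivers f S i.+1 q x -> x \in B i.+1) ->
  {subset reach f S v k <= B k}.
Proof.
move=> h0 hm hc; have: k <= k by [].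
elim: {-2}k => [|i IH] hi x; first by rewrite inE => /eqP->.
case/reachS=> [/(IH (ltnW hi))/hm|[u hu hd]]; first exact.
exact: hc (IH (ltnW hi) _ hu) hu hd.
Qed.

Lemma reach_sub f S f' S' v k :
  (forall i q x, i < k -> q \in reach f S v i -> q \in reach f' S' v i ->
     delivers f S i.+1 q x -> x \in reach f' S' v i.+1) ->
  {subset reach f S v k <= reach f' S' v k}.
Proof.
move=> h; apply: (@reach_min f S v k (reach f' S' v)) => //.
- by rewrite inE.
- by move=> i _ x; apply: reach_monoP.
- by move=> i q x hi hq hq'; apply: h.
Qed.

Lemma reach_sub_delivers f S f' S' v k :
  (forall i q x, i < k -> delivers f S i.+1 q x -> delivers f' S' i.+1 q x) ->
  {subset reach f S v k <= reach f' S' v k}.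
Proof.
move=> h; apply: reach_sub => i q x hi _ hq /(h _ _ _ hi); exact: reach_step.
Qed.

(* The per-round condition of [cpath]. *)
Definition pdelivers phi i u x :=
  [&& e u x, ~~ ((u \in pfaulty phi) && (pround phi u < i))
    & ((u \in pfaulty phi) && (pround phi u == i)) ==> (x \notin pset phi u)].

Lemma cpath_cat phi i u s1 s2 :
  cpath e phi i u (s1 ++ s2) =
  cpath e phi i u s1 && cpath e phi (i + size s1) (last u s1) s2.
Proof.
elim: s1 i u => [|w s1 IH] i u /=; first by rewrite addn0.
by rewrite IH addSnnS -!andbA.
Qed.

Definition represents r phi f S :=
  forall i u x, 0 < i <= r -> pdelivers phi i u x = delivers f S i u x.

(** A causal path cannot wait, while [reach] lets a node send long after it was reached. Both agree
    because a message delivered in some round would also be delivered in every earlier round. *)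
Lemma reachP r phi f S v i x : represents r phi f S -> i <= r ->
  reflect (exists2 s, size s <= i & cpath e phi 1 v s /\ last v s = x)
          (x \in reach f S v i).
Proof.
move=> rep ir; apply: (iffP idP).
  elim: i x ir => [|i IH] x ir.
    by rewrite inE => /eqP->; exists [::].
  case/reachS=> [/(IH _ (ltnW ir))[s hs hp]|[u hu hd]].
    by exists s => //; apply: leq_trans hs _.
  have [s hs [hp hl]] := IH _ (ltnW ir) hu.
  exists (rcons s x); first by rewrite size_rcons.
  rewrite last_rcons; split=> //; rewrite -cats1 cpath_cat hp /= hl.
  have := rep (1 + size s) u x; rewrite /pdelivers andbT => ->; last by lia.
  move: hd; rewrite /delivers; case/and3P => -> h1 /implyP h2 /=.
  apply/andP; split; first by lia.
  by apply/implyP=> /eqP h3; apply: h2; lia.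
case=> s hs [hp <-]; elim/last_ind: s i ir hs hp => [|s z IH] i ir hs.
  by move=> _; apply: (@reach_monoP _ _ _ 0); rewrite ?inE.
move: hs; rewrite size_rcons last_rcons -cats1 cpath_cat /= => hs.
case/andP=> hp hd.
apply: (@reach_monoP _ _ _ (size s).+1); first by lia.
apply: (@reach_step _ _ _ _ (last v s)); first by apply: IH => //; lia.
rewrite -rep; last by lia.
by move: hd; rewrite andbT.
Qed.

Lemma path_withinP phi v x r :
  reflect (exists2 s, size s <= r & cpath e phi 1 v s /\ last v s = x)
          (path_within e phi v x r).
Proof.
apply: (iffP existsP) => [[k /existsP[s /andP[hp /eqP hl]]]|[s hs [hp hl]]].
  by exists (tval s) => //; rewrite size_tuple; have := ltn_ord k; lia.
have hk : size s < r.+1 by [].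
exists (Ordinal hk); apply/existsP; exists (in_tuple s).
by rewrite hp hl /=.
Qed.

Lemma path_within_reach phi f S v x r : represents r phi f S ->
  path_within e phi v x r = (x \in reach f S v r).
Proof. by move=> rep; apply/path_withinP/(reachP _ _ rep (leqnn r)). Qed.

Lemma view_reach (I : Type) phi f S (x : T -> I) v r : represents r phi f S ->
  view e phi x v r =
  [ffun u => if v \in reach f S u r then Some (x u) else None].
Proof.
move=> rep; apply/ffunP=> u; rewrite !ffunE (path_within_reach _ _ rep).
case: eqP => [->|//]; by rewrite (@reach_monoP _ _ _ 0) // inE.
Qed.

(* A crash at round [g u] that loses nothing is presented as a silent crash one
   round later, because the sets F_v of a failure pattern are nonempty. *)
Definition config_pattern r g S : pattern T :=
  Pattern [set u | g u <= r]
    (fun u => if S u :&: nbhd e u == set0 then nbhd e u else S u :&: nbhd e u)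
    (fun u => if S u :&: nbhd e u == set0 then (g u).+1 else g u).

Lemma represents_config r g S : represents r (config_pattern r g S) g S.
Proof.
move=> i u x /andP[i0 ir]; rewrite /pdelivers /delivers /= inE.
case exu: (e u x) => //=.
case: ifP => [/eqP/setP/(_ x)|_]; rewrite !inE exu !andbT ?andbF.
  by move=> ->; rewrite implybT; lia.
by case: (x \in S u); lia.
Qed.

Lemma valid_config r t g S : #|[set u | g u <= r]| <= t ->
  (forall u, g u <= r -> 0 < g u /\ nbhd e u != set0) ->
  valid_pattern e t (config_pattern r g S).
Proof.
move=> ht h; split=> // u; rewrite /= inE => /h[g0 nb].
case: ifP => [_|/negbT h0]; first by split.
by split=> //; apply: subsetIr.
Qed.

Definition failure_free r : pattern T :=
  config_pattern r (fun=> r.+1) (fun=> set0).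

Lemma valid_failure_free t r : valid_pattern e t (failure_free r).
Proof.
apply: valid_config => [|u]; last by rewrite ltnn.
by rewrite (_ : [set u | _] = set0) ?cards0 //; apply/setP=> u; rewrite !inE ltnn.
Qed.

End Flooding.

(** * Latest possible crashes and the existence of relays *)

Section Extremal.

Variables (T : finType) (e : rel T) (t r : nat) (v : T).
Hypothesis e_sym : symmetric e.
Implicit Types (f g : T -> nat) (S : T -> {set T}).

Definition admissible f :=
  (forall u, 0 < f u <= r.+1) /\ #|[set u | f u <= r]| <= t.

Definition partial_reach f S :=
  exists w y, [/\ r < f w, w \notin reach e f S v r, r < f y & y \in reach e f S v r].

(** Potential for the descent: each postponement of a crash decreases it. *)
Definition lost_rounds f := \sum_u (r.+1 - f u).

Definition improvable f :=
  exists f' S', [/\ admissible f', partial_reach f' S'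
                  & lost_rounds f' < lost_rounds f].

Definition delay f u : T -> nat := fun z => if z == u then (f u).+1 else f z.

Lemma delay_ge f u z : f z <= delay f u z.
Proof. by rewrite /delay; case: eqP => [->|_]. Qed.

Lemma admissible_delay f u : f u <= r -> admissible f -> admissible (delay f u).
Proof.
move=> fu [h1 h2]; split=> [z|].
  by rewrite /delay; case: eqP => _ //; lia.
apply: leq_trans h2; apply/subset_leq_card/subsetP => z; rewrite !inE.
by apply: leq_trans; apply: delay_ge.
Qed.

Lemma lost_rounds_delay f u : f u <= r -> lost_rounds (delay f u) < lost_rounds f.
Proof.
move=> fu; rewrite /lost_rounds (bigD1 u) //= [in X in _ < X](bigD1 u) //=.
rewrite {1}/delay eqxx; rewrite [X in _ + X < _](_ : _ = \sum_(i | i != u) (r.+1 - f i)).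
  by lia.
by apply: eq_bigr => z /negbTE zu; rewrite /delay zu.
Qed.

Lemma improve_delay f S S' u : f u <= r -> admissible f -> partial_reach f S ->
  {subset reach e (delay f u) S' v r <= reach e f S v r} ->
  (forall y, r < f y -> y \in reach e f S v r ->
     y \in reach e (delay f u) S' v r) ->
  improvable f.
Proof.
move=> fu adm [w [y [fw hw fy hy]]] h1 h2.
exists (delay f u), S'; split.
- exact: admissible_delay.
- exists w, y; split.
  + exact: leq_trans fw (delay_ge _ _ _).
  + by apply: contra hw; apply: h1.
  + exact: leq_trans fy (delay_ge _ _ _).
  + exact: h2.
- exact: lost_rounds_delay.
Qed.

(* A node reached two rounds before its crash has already informed all its
   neighbours, hence surviving one more round changes nothing. *)
Lemma improve_idle_crash f S u j : f u = j.+2 -> f u <= r -> admissible f ->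
  partial_reach f S -> u \in reach e f S v j -> improvable f.
Proof.
move=> fu fur adm part hu.
(* Postponed by one round, [u] crashes silently: it sends everything in round [j.+2] and nothing in
   the next. *)
apply: (@improve_delay f S (fun z => if z == u then nbhd e u else S z) u) => //.
- apply: reach_sub => i q x ir _ hq.
  rewrite /delivers /delay; cbv beta; case: (q =P u) => [qu|_]; last exact: (reach_step hq).
  subst q; case/and3P => eux h1 h2.
  have ifu : i < f u.
    rewrite ltn_neqAle -ltnS h1 andbT; apply/eqP => iE.
    by move: h2; rewrite iE eqxx inE eux.
  have [ij|ji] := leqP i j.
    by apply: (reach_step hq); rewrite /delivers eux; apply/andP; split; lia.
  apply: (@reach_monoP _ _ _ _ _ j.+1); first by lia.
  by apply: (reach_step hu); rewrite /delivers eux; apply/andP; split; lia.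
- move=> y _; apply: reach_sub_delivers => i q x ir.
  rewrite /delivers /delay /=; case: (q =P u) => [->|//] /and3P[-> h1 _].
  by rewrite /=; apply/andP; split; [lia|apply/implyP; lia].
Qed.

Definition has_relay f S u :=
  [exists y, [&& e u y, y \in reach e f S v (f u) & f u < f y]].

(* If [u] is reached no earlier than the round before its crash, only by nodes
   crashing at that moment, and informs only nodes that are dead afterwards,
   then hiding the information from [u] and delaying its crash loses no
   surviving node. *)
Lemma improve_hide f S u k : f u = k.+1 -> f u <= r -> admissible f ->
  partial_reach f S -> ~~ has_relay f S u -> (k = 0 -> u != v) ->
  (forall j, k = j.+1 -> u \notin reach e f S v j /\
     forall p, p \in reach e f S v j -> delivers e f S j.+1 p u -> f p = j.+1) ->
  improvable f.
Proof.
move=> fu fur adm part rel k0 kS.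
have no_early i : i < k -> u \notin reach e f S v i.
  case: k {fu k0} kS => // j /(_ _ erefl)[uj _] ij.
  by apply: contra uj; apply: reach_monoP.
(* Nodes crashing in round [k] now also lose their message to [u], and [u] loses all its messages in
   round [k.+2], so it learns nothing in time to pass it on. *)
pose S' z := if z == u then nbhd e u else if f z == k then u |: S z else S z.
have vu : v != u.
  case: (posnP k) => [/k0|kpos]; first by rewrite eq_sym.
  by have := no_early _ kpos; apply: contra => /eqP<-; rewrite (@reach_monoP _ _ _ _ _ 0) ?inE.
have u_late i x : delivers e (delay f u) S' i.+1 u x -> i <= k.
  rewrite /delivers /delay /S' eqxx => /and3P[eux h1 h2].
  rewrite -ltnS -fu ltn_neqAle -ltnS h1 andbT; apply/eqP => iE.
  by move: h2; rewrite iE eqxx inE eux.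
have deliver_keep i q x : q != u ->
    delivers e (delay f u) S' i.+1 q x -> delivers e f S i.+1 q x.
  move=> /negbTE qu; rewrite /delivers /delay /S' qu.
  case/and3P=> -> -> /= /implyP h; apply/implyP=> /h.
  by case: (f q == k) => //; rewrite in_setU1 negb_or => /andP[].
have sub m : {subset reach e (delay f u) S' v m <=
                (if m <= k then reach e f S v m :\ u else reach e f S v m)}.
  apply: (@reach_min _ _ _ _ _ m
    (fun i => if i <= k then reach e f S v i :\ u else reach e f S v i)).
  - by rewrite /= !inE vu eqxx.
  - move=> i _ x; case: (leqP i.+1 k) => ik.
      rewrite (ltnW ik) !in_setD1 => /andP[-> hx].
      by rewrite (reach_monoP (leqnSn i) hx).
    case: ifP => _; last exact: reach_monoP.
    by rewrite in_setD1 => /andP[_]; apply: reach_monoP.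
  - move=> i q x _ qB _ hd.
    have qu : q != u.
      apply: contraL qB => /eqP qu; subst q.
      by rewrite (u_late _ _ hd) setD11.
    have hq : q \in reach e f S v i.
      by move: qB; case: ifP => // _; rewrite in_setD1 => /andP[].
    have hd0 := deliver_keep _ _ _ qu hd.
    have hx := reach_step hq hd0.
    case: ifP => // ik; rewrite in_setD1 hx andbT.
    apply/eqP=> xu; subst x.
    have kE : k = i.+1.
      apply/eqP; rewrite eqn_leq ik andbT leqNgt.
      by apply: contraL hx => h; apply: no_early.
    have [_ /(_ _ hq hd0) fq] := kS _ kE.
    case/and3P: hd => _ _; rewrite /delay /S' (negbTE qu) fq kE eqxx /=.
    by rewrite setU11.
apply: (@improve_delay f S S' u) => //.
- by move=> x /sub; case: ifP => // _; rewrite inE; case/andP.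
move=> y fy hy.
(* Conversely, a node reached before is still reached, unless it is [u] or has crashed by round
   [f u]; the latter send nothing after round [k.+1], so the loss does not spread. *)
pose B i := reach e f S v i :&: (u |: reach e (delay f u) S' v i :|:
              (if i <= k then set0 else [set x | f x <= f u])).
have inB i x : (x \in B i) = (x \in reach e f S v i) &&
    [|| x == u, x \in reach e (delay f u) S' v i | (k < i) && (f x <= f u)].
  by rewrite in_setI in_setU in_setU1 orbA ltnNge; case: ifP; rewrite inE.
suff: y \in B r.
  rewrite inB => /andP[_ /or3P[/eqP yu|//|/andP[_ h]]]; last by lia.
  by move: fy; rewrite yu; lia.
apply: (@reach_min _ e f S v r B) hy.
- by rewrite inB !inE eqxx orbT.
- move=> i _ x; rewrite !inB => /andP[h1 h2].
  rewrite (reach_monoP (leqnSn i) h1).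
  case/or3P: h2 => [->//|h2|/andP[h2 ->]].
    by rewrite (reach_monoP (leqnSn i) h2) orbT.
  by rewrite (leq_trans h2 (leqnSn i)) !orbT.
- move=> i q x _; rewrite !inB => /andP[_ qB] hq hd.
  have hx := reach_step hq hd; rewrite hx.
  case: (x =P u) => xu //.
  have [qu|qu] := eqVneq q u.
    subst q; case/and3P: (hd) => eux h1 _.
    have ik : i = k.
      apply/eqP; rewrite eqn_leq -ltnS -fu h1 /= leqNgt.
      by apply: contraL hq; apply: no_early.
    apply/or3P/Or33; rewrite ik leqnn andTb leqNgt.
    apply: contra rel => h; apply/existsP; exists x.
    by rewrite eux h fu -ik hx.
  move: qB; rewrite (negbTE qu) orFb => /orP[hq'|].
    apply/or3P/Or32; apply: (reach_step hq'); move: hd.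
    rewrite /delivers /delay /S' (negbTE qu).
    by case: (f q == k); rewrite ?in_setU1 //; case: (x =P u) xu.
  by case/and3P: hd => _ h1 _; lia.
Qed.

Lemma improve_no_relay f S u : f u <= r -> admissible f ->
  partial_reach f S -> ~~ has_relay f S u -> improvable f.
Proof.
move=> fur adm part rel.
have [k fu] : exists k, f u = k.+1.
  by case: adm => /(_ u) + _; case: (f u) => // k; exists k.
have dead x : e u x -> x \in reach e f S v (f u) -> f x <= f u.
  move=> eux hx; rewrite leqNgt; apply: contra rel => h.
  by apply/existsP; exists x; rewrite eux hx.
case: k fu => [|j] fu.
  have [uv|uv] := eqVneq u v; last by apply: (improve_hide (S := S) fu).
  (* If [u = v] crashes in round 1, only nodes crashing in that round are ever reached,
     contradicting the surviving [y]. *)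
  case: part => _ [y [_ _ fy hy]].
  suff: y \in [set x | f x <= 1] by rewrite inE; lia.
  apply: (@reach_min _ e f S v r (fun=> [set x | f x <= 1])) hy.
  - by rewrite inE -uv fu.
  - by move=> ? _ ?.
  move=> i q x _; rewrite !inE => fq hq hd.
  have i0 : i = 0 by case/and3P: hd; lia.
  subst i; have qu : q = u by move: hq; rewrite inE uv => /eqP.
  rewrite -fu; apply: dead; first by case/and3P: hd; rewrite qu.
  by rewrite fu; apply: reach_step hd.
case: (boolP (u \in reach e f S v j)) => [|uj].
  exact: (improve_idle_crash fu).
case: (boolP [exists p in reach e f S v j,
    delivers e f S j.+1 p u && (f p != j.+1)]) => [/existsP|/existsPn nop].
  (* As a neighbour of [u] reached in time, [p] would be a relay unless [f p <= f u]; so it crashes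
     in round [j.+2], although reached by round [j]. *)
  case=> p /and3P[hp hd fp]; case/and3P: (hd) => epu h1 _.
  have h2 : f p <= f u.
    apply: dead; first by rewrite e_sym.
    by apply: reach_monoP hp; lia.
  have fpE : f p = j.+2 by lia.
  by apply: (improve_idle_crash fpE) hp => //; lia.
apply: (improve_hide (S := S) fu) => // _ [<-]; split=> // p hp hd.
by have := nop p; rewrite hp hd /= negbK => /eqP.
Qed.

Lemma relay_exists f S : admissible f -> partial_reach f S ->
  exists f' S', [/\ admissible f', partial_reach f' S'
                  & forall u, f' u <= r -> has_relay f' S' u].
Proof.
have [n] := ubnP (lost_rounds f); elim: n f S => // n IH f S hn adm part.
case: (boolP [exists u, (f u <= r) && ~~ has_relay f S u]).
  case/existsP=> u /andP[fu hu].
  have [f' [S' [adm' part' lt]]] := improve_no_relay fu adm part hu.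
  by apply: (IH f' S') => //; lia.
move/existsPn=> h; exists f, S; split=> // u fu.
by have := h u; rewrite fu negbK.
Qed.

End Extremal.

(** * Postponing crashes without changing the decision *)

Section Connectivity.

Variables (T : finType) (e : rel T) (I : Type) (t r : nat).
Variable out : T -> {ffun T -> option I} -> I.
Hypothesis out_solves : oblivious_solves_consensus e t r out.

Variables (f : T -> nat) (S0 : T -> {set T}) (v w : T) (relay : T -> T).
Hypothesis f_adm : admissible t r f.
Hypothesis w_correct : r < f w.
Hypothesis w_unreached : w \notin reach e f S0 v r.
Hypothesis relayP : forall u, f u <= r ->
  [/\ e u (relay u), relay u \in reach e f S0 v (f u) & f u < f (relay u)].

Implicit Types (g : T -> nat) (S : T -> {set T}).

(** Since [f] increases strictly from a crashing node to its relay, among the nodes crashing in a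
    given round one with maximal [f] has a relay that outlives this round. *)
Definition later_crashes g :=
  (forall u, f u <= g u <= r.+1) /\ (forall u, f u <= r -> g u <= g (relay u)).

Definition decision x g S := out w (view e (config_pattern e r g S) x w r).

Lemma later_crashes_valid g S : later_crashes g ->
  valid_pattern e t (config_pattern e r g S).
Proof.
case=> hg _; case: f_adm => f0 ft; apply: valid_config.
  apply: leq_trans ft; apply/subset_leq_card/subsetP=> u; rewrite !inE.
  by have := hg u; lia.
move=> u gu; have fgu := hg u; have f0u := f0 u; split; first by lia.
have [|eu _ _] := @relayP u; first by lia.
by apply/set0Pn; exists (relay u); rewrite inE.
Qed.

(** By agreement the decision can be read off at any node [z] correct in both configurations, and
    equal views of [z] force equal outputs. *)
Lemma decision_witness x g S g' S' z :
  later_crashes g -> later_crashes g' -> r < g z -> r < g' z ->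
  (forall a, (z \in reach e g S a r) = (z \in reach e g' S' a r)) ->
  decision x g S = decision x g' S'.
Proof.
move=> hg hg' gz gz' same.
have correct g1 u : later_crashes g1 -> r < g1 u -> forall S1,
    decision x g1 S1 = out u (view e (config_pattern e r g1 S1) x u r).
  move=> h1 h2 S1; case: (out_solves x (later_crashes_valid S1 h1)) => agree _.
  apply: agree; rewrite inE -ltnNge //.
  by case: h1 => /(_ w) + _; lia.
rewrite (correct _ _ hg gz) (correct _ _ hg' gz').
rewrite !(view_reach _ _ (@represents_config _ e r _ _)); congr (out z _).
by apply/ffunP=> a; rewrite !ffunE same.
Qed.

Lemma later_crashes_w g : later_crashes g -> r < g w.
Proof. by case=> /(_ w) + _; have := w_correct; lia. Qed.

Lemma decision_ext x g S g' S' : later_crashes g -> later_crashes g' ->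
  (forall i u z, i < r -> delivers e g S i.+1 u z = delivers e g' S' i.+1 u z) ->
  decision x g S = decision x g' S'.
Proof.
move=> hg hg' same; apply: (@decision_witness _ _ _ _ _ w); rewrite ?later_crashes_w //.
by move=> a; apply/idP/idP; apply: reach_sub_delivers => i q z ir; rewrite same.
Qed.

Definition truncate h g : T -> nat := fun u => if g u < h then g u else r.+1.

Lemma later_crashes_truncate h g : later_crashes g -> later_crashes (truncate h g).
Proof.
case=> h1 h2; split=> u; rewrite /truncate.
  by have := h1 u; case: ifP; lia.
move=> /h2 h3; have := h1 u; have := h1 (relay u).
by case: ifP; case: ifP; lia.
Qed.

Definition update (X : Type) (s : T -> X) u (a : X) : T -> X :=
  fun z => if z == u then a else s z.

(* Nodes with [f z <= h] are silent after round [h] and the others behave as in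
   the base configuration, where [w] learns nothing from the relay of [u]: so
   [w] does not notice whether the relay hears from [u]. *)
Lemma decision_inform_relay x g S u h : later_crashes g -> g u = h -> h <= r ->
  (forall z, h < g z -> g z = maxn h.+1 (f z)) ->
  (forall z, h < g z -> S z = if f z <= h then nbhd e z else S0 z) ->
  decision x g S = decision x g (update S u (S u :\ relay u)).
Proof.
move=> hg gu hr gE SE; have [hg1 _] := hg.
have fu : f u <= h by have := hg1 u; lia.
have [|eu ru _] := @relayP u; first by lia.
apply: (@decision_witness _ _ _ _ _ w); rewrite ?later_crashes_w // => a.
apply/idP/idP.
  apply: reach_sub_delivers => i q z ir; rewrite /delivers /update.
  case: (q =P u) => // -> /and3P[-> -> /implyP h1] /=.
  by apply/implyP=> /h1; rewrite in_setD1 negb_and => ->; rewrite orbT.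
(* From round [h] on, [B] adds the nodes that [v] reaches in the base configuration. All
   consequences of informing the relay stay among these, and [w] is not one of them. *)
pose B i := reach e g S a i :|: (if i < h then set0 else reach e f S0 v i).
have inB i z : (z \in B i) = (z \in reach e g S a i) ||
    (h <= i) && (z \in reach e f S0 v i).
  by rewrite in_setU [h <= i]leqNgt; case: (i < h); rewrite ?in_set0.
move=> hw; suff: w \in B r by rewrite inB hr (negbTE w_unreached) orbF.
apply: (@reach_min _ e g _ a r B) hw.
- by rewrite inB inE eqxx.
- move=> i _ z; rewrite !inB => /orP[h1|/andP[h1 h2]].
    by rewrite (reach_monoP (leqnSn i) h1).
  by rewrite (reach_monoP (leqnSn i) h2) (leq_trans h1 (leqnSn i)) orbT.
move=> i q z ir; rewrite !inB => /orP[hq|/andP[hi hq]] _ hd.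
  case: (boolP (delivers e g S i.+1 q z)) => [/(reach_step hq)->//|nd].
  move: hd nd; rewrite /delivers /update; case: (q =P u) => [->|_ -> //].
  case/and3P=> -> -> /=; case: (i.+1 =P g u) => //= iE.
  rewrite in_setD1 !negb_and !negbK => /orP[/eqP->|/negbTE->//] _.
  by rewrite iE gu leqnn (reach_monoP fu ru) orbT.
apply/orP; right; rewrite (leq_trans hi (leqnSn i)); apply: (reach_step hq).
case/and3P: hd => eqz h1 h2.
have gq : h < g q by lia.
have qu : (q == u) = false by apply/eqP=> qu; move: gq; rewrite qu gu ltnn.
move: h1 h2; rewrite /delivers /update qu eqz (gE _ gq) (SE _ gq).
case: (leqP (f q) h) => fq.
  have -> : maxn h.+1 (f q) = h.+1 by lia.
  move=> h1; have -> : i.+1 == h.+1 by lia.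
  by rewrite inE eqz.
by rewrite (maxn_idPr fq) => -> ->.
Qed.

(** The relay is the witness: if [u] knows an input before round [h], the relay gets it in both
    configurations; otherwise the messages of [u] in round [h] do not carry it. *)
Lemma decision_complete_round x g S u h : later_crashes g -> g u = h -> h <= r ->
  r < g (relay u) -> relay u \notin S u ->
  decision x g S = decision x g (update S u set0).
Proof.
move=> hg gu hr gr ruS; have [hg1 _] := hg.
have [|eu _ _] := @relayP u; first by have := hg1 u; lia.
have [k hk] : exists k, h = k.+1.
  case: f_adm => /(_ u) + _; have := hg1 u; rewrite gu.
  by case: h {gu hr} => [|k]; [lia|exists k].
apply: (@decision_witness _ _ _ _ _ (relay u)) => // a; apply/idP/idP.
  apply: reach_sub_delivers => i q z ir; rewrite /delivers /update.
  by case: (q =P u) => // -> /and3P[-> -> _]; rewrite inE implybT.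
move=> hy; case: (boolP (u \in reach e g S a k)) => uk.
  apply: (@reach_monoP _ _ _ _ _ h) => //; rewrite hk; apply: (reach_step uk).
  by rewrite /delivers eu ruS gu hk leqnn implybT.
move: hy; apply: reach_sub => i q z ir _ hq.
rewrite /delivers /update; case: (q =P u) => [qu|_]; last exact: (reach_step hq).
subst q; case/and3P=> euz h1 _; apply: (reach_step hq).
rewrite /delivers euz h1 /=; apply/implyP=> /eqP iE.
suff ik : i = k by rewrite -ik hq in uk.
by lia.
Qed.

(** The outer induction removes crashes round by round, starting with the last round; the inner one
    postpones those of round [h] one at a time. *)
Lemma decision_truncate x k g S : k <= r.+1 -> later_crashes g ->
  decision x g S = decision x (truncate (r.+1 - k) g) S.
Proof.
elim: k g S => [|k IHk] g S kr hg.
  apply: decision_ext => //; first exact: later_crashes_truncate.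
  move=> i u z ir; rewrite /delivers /truncate subn0.
  by have [/(_ u) + _] := hg; case: (ltnP (g u) r.+1) => // h1 h2; have -> : g u = r.+1 by lia.
set h := r.+1 - k.+1.
have hS : r.+1 - k = h.+1 by rewrite /h; lia.
have hr : h <= r by rewrite /h; lia.
have {}IHk g1 S1 : later_crashes g1 ->
    decision x g1 S1 = decision x (truncate h.+1 g1) S1.
  by move=> ?; rewrite -hS; apply: IHk => //; lia.
(* Crashes after round [h] do not affect the decision, so they may be rearranged freely. *)
have agree g1 S1 g2 S2 : later_crashes g1 -> later_crashes g2 ->
    (forall z, g1 z <= h \/ g2 z <= h -> g1 z = g2 z /\ S1 z = S2 z) ->
    decision x g1 S1 = decision x g2 S2.
  move=> h1 h2 same; rewrite (IHk g1) // (IHk g2) //.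
  apply: decision_ext; try exact: later_crashes_truncate.
  move=> i u z ir; rewrite /delivers /truncate !ltnS.
  case: (leqP (g1 u) h) => c1.
    by have [<- <-] := same u (or_introl c1); rewrite c1.
  case: (leqP (g2 u) h) => c2.
    by have [E _] := same u (or_intror c2); lia.
  by have -> : (i.+1 == r.+1) = false by lia.
clearbody h.
have [n] := ubnP #|[set u | g u == h]|; elim: n g S hg => // n IHn g S hg hn.
case: (pickP (fun u => g u == h)) => [u0 hu0|none]; last first.
  rewrite IHk //; apply: decision_ext; try exact: later_crashes_truncate.
  move=> i u z ir; rewrite /delivers /truncate.
  by rewrite (_ : (g u < h.+1) = (g u < h)) // ltnS leq_eqVlt none.
(* Maximality of [f u] keeps the relay of [u] from crashing in round [h] too. *)
case: (@arg_maxnP _ u0 (fun u => g u == h) f hu0) => u /eqP gu umax.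
have [hg1 hg2] := hg.
have fu : f u <= r by have := hg1 u; lia.
have [eu ru fru] := relayP fu.
have gru : h < g (relay u).
  have := hg2 u fu; rewrite gu leq_eqVlt => /orP[/eqP gE|//].
  by have := umax (relay u); rewrite -gE eqxx => /(_ isT) /=; lia.
(* Crashes after round [h] move as early as possible: nodes with [f z <= h] fall silent in round
   [h.+1], the others follow the base configuration. *)
pose g3 z := if g z <= h then g z else maxn h.+1 (f z).
pose S3 z := if g z <= h then S z else if f z <= h then nbhd e z else S0 z.
have hg3 : later_crashes g3.
  split=> z; first by have := hg1 z; rewrite /g3; case: ifP; lia.
  move=> fz; have := hg2 z fz; have [_ _] := relayP fz; rewrite /g3.
  by case: (leqP (g z) h); case: (leqP (g (relay z)) h); lia.
rewrite (agree g S g3 S3) //; last first.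
  move=> z; rewrite /g3 /S3; case: (leqP (g z) h) => // h1 [|]; lia.
have g3u : g3 u = h by rewrite /g3 gu leqnn.
have g3E z : h < g3 z -> g3 z = maxn h.+1 (f z).
  by rewrite /g3; case: (leqP (g z) h) => //; lia.
have S3E z : h < g3 z -> S3 z = if f z <= h then nbhd e z else S0 z.
  by rewrite /g3 /S3; case: (leqP (g z) h) => //; lia.
rewrite (decision_inform_relay x hg3 g3u hr g3E S3E).
(* Now the opposite extreme: no crash after round [h], so the relay is correct. *)
pose g4 := truncate h.+1 g; pose S4 := update S u (S u :\ relay u).
have hg4 : later_crashes g4 by exact: later_crashes_truncate.
have g4u : g4 u = h by rewrite /g4 /truncate gu leqnn.
rewrite (agree g3 _ g4 S4) //; last first.
  move=> z; rewrite /g3 /S3 /g4 /S4 /truncate /update ltnS.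
  case: (z =P u) => [->|_]; first by rewrite gu leqnn.
  by case: (leqP (g z) h) => // h1 [|]; lia.
have g4r : g4 (relay u) = r.+1 by rewrite /g4 /truncate ltnS leqNgt gru.
rewrite (@decision_complete_round x g4 S4 u h) ?g4r //; last first.
  by rewrite /S4 /update eqxx setD11.
(* A crash in round [h] that loses nothing equals a silent crash one round later, which leaves fewer
   crashes in round [h]. *)
pose g5 := update g4 u h.+1.
have hg5 : later_crashes g5.
  have [h1 h2] := hg4; split=> z; rewrite /g5 /update.
    by case: eqP => [->|_]; [have := hg1 u; lia|exact: h1].
  move=> fz; have := h2 z fz; have [_ _] := relayP fz.
  case: (z =P u) => [->|_].
    by move=> fz' _; case: eqP => [E|_]; [move: fz'; rewrite E; lia|rewrite g4r].
  by case: eqP => [->|//]; rewrite g4u; lia.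
rewrite (@decision_ext x _ _ g5 (update S u (nbhd e u))) //; last first.
  move=> i q z _; rewrite /g5 /S4 /delivers /update.
  case: (q =P u) => // ->; rewrite g4u !inE implybT andbT.
  by case: (e u z) => //=; lia.
have lt5 : #|[set z | g5 z == h]| < #|[set z | g z == h]|.
  apply: proper_card; apply/properP; split.
    apply/subsetP=> z; rewrite !inE /g5 /g4 /update /truncate.
    by case: (z =P u) => _; [lia|case: ifP; lia].
  by exists u; rewrite inE ?gu ?eqxx // /g5 /update eqxx; lia.
rewrite (IHn g5 _ hg5 (leq_trans lt5 _)) //.
apply: decision_ext; try exact: later_crashes_truncate.
move=> i q z ir; rewrite /delivers /truncate /g5 /g4 /update /truncate.
case: (q =P u) => [->|_].
  have -> : (h.+1 < h) = false by lia.
  by rewrite gu ltnn; have -> : (i.+1 == r.+1) = false by lia.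
rewrite ltnS; case: (leqP (g q) h) => c //.
have -> : (r.+1 < h) = false by lia.
by have -> : (g q < h) = false by lia.
Qed.

Lemma decision_failure_free x :
  decision x f S0 = decision x (fun=> r.+1) (fun=> set0).
Proof.
have hf : later_crashes f.
  case: f_adm => h _; split=> u; first by have := h u; lia.
  by move=> /relayP[_ _]; apply: ltnW.
have hT : later_crashes (fun=> r.+1).
  by case: f_adm => h _; split=> u //; have := h u; lia.
rewrite (decision_truncate x S0 (leqnn _) hf) subnn.
apply: (decision_ext _ (later_crashes_truncate 0 hf) hT).
move=> i u z ir; rewrite /delivers /truncate ltn0.
by have -> : (i.+1 == r.+1) = false by lia.
Qed.

End Connectivity.

(** * From the radius to configurations with partial reach *)

Section Radius.

Variables (T : finType) (e : rel T) (t : nat).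

(** Some correct [w] has a causal path from [v], but none of length at most [r]. The node numbered
    [r.+1] on this path is reached after [r] rounds and still alive to send in round [r.+1]. *)
Lemma partial_reach_of_ecc r phi v : in_Phi_star e t v phi -> r < ecc e phi v ->
  exists f S, admissible t r f /\ partial_reach e r v f S.
Proof.
case=> [[cF vF] fin]; rewrite /ecc.
case: excluded_middle_informative => [H|//].
case: ex_minnP => m /forallP eccm minm rm.
have /forallPn[w] : ~~ ecc_le e phi v r by apply/negP=> /minm; lia.
rewrite negb_imply => /andP[wF nw].
(* Crashes after round [r] are invisible during [r] rounds and are discarded. *)
pose f u := if u \in pfaulty phi then minn (pround phi u) r.+1 else r.+1.
have rep : represents e r phi f (pset phi).
  move=> i u x /andP[i0 ir]; rewrite /pdelivers /delivers /f.
  case: (u \in pfaulty phi) => /=.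
    by case: (e u x) => //=; case: (x \in pset phi u) => /=; lia.
  by case: (e u x) => //=; case: (x \in pset phi u) => /=; lia.
exists f, (pset phi); split.
  split=> [u|].
    by rewrite /f; case: ifP => [/vF[]|]; lia.
  apply: leq_trans cF; apply/subset_leq_card/subsetP=> u; rewrite inE /f.
  by case: ifP => //; lia.
have := eccm w; rewrite wF => /path_withinP[s hs [hp hl]].
have rs : r < size s.
  by rewrite ltnNge; apply: contra nw => h; apply/path_withinP; exists s.
move: hp; rewrite -(cat_take_drop r s) cpath_cat => /andP[hp1].
rewrite size_takel ?(ltnW rs) // (drop_nth v rs) /= => /and4P[_ alive _ _].
exists w, (last v (take r s)); split.
- by rewrite /f (negbTE wF).
- by rewrite -(path_within_reach _ _ rep).
- by move: alive; rewrite /f; case: ifP => //= _; lia.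
- apply/(reachP _ _ rep (leqnn r)); exists (take r s) => //.
  by rewrite size_takel // ltnW.
Qed.

Lemma pbP (P : Prop) : reflect P (pb P).
Proof. by rewrite /pb; case: excluded_middle_informative => h; constructor. Qed.

(** Otherwise [r] bounds the worst eccentricity of [v], hence the radius, which is then finite. *)
Lemma slow_pattern r v : lt_radius r (radius e t) ->
  exists2 phi, in_Phi_star e t v phi & r < ecc e phi v.
Proof.
move=> rR; apply: NNPP => no.
have bound phi : in_Phi_star e t v phi -> ecc e phi v <= r.
  by move=> h; rewrite leqNgt; apply/negP=> h'; apply: no; exists phi.
have [B BE Br] : exists2 B, max_ecc e t v = Some B & B <= r.
  rewrite /max_ecc; case: excluded_middle_informative => [H|[]]; last first.
    by exists r; apply/pbP.
  by eexists; first reflexivity; case: ex_minnP => m _; apply; apply/pbP.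
move: rR; rewrite /radius; case: excluded_middle_informative => [H|[]] /=.
  case: ex_minnP => m _ /(_ B) h; suff: m <= B by lia.
  by apply: h; apply/existsP; exists v; rewrite BE.
by exists B; apply/existsP; exists v; rewrite BE.
Qed.

End Radius.

(** * Independence of the inputs and the contradiction with validity *)

Lemma decision_independent (T : finType) (e : rel T) (I : Type) (t r : nat)
    (out : T -> {ffun T -> option I} -> I) (v v0 : T) (x x' : T -> I) :
  symmetric e -> oblivious_solves_consensus e t r out ->
  lt_radius r (radius e t) -> (forall u, u != v -> x u = x' u) ->
  let free := failure_free e r in
  out v0 (view e free x v0 r) = out v0 (view e free x' v0 r).
Proof.
move=> sym sol rR xx' free.
have [phi phiS rphi] := slow_pattern v rR.
have [f1 [S1 [adm1 part1]]] := partial_reach_of_ecc phiS rphi.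
have [f [S [adm [w [_ [fw hw _ _]]] rel]]] := relay_exists sym adm1 part1.
(* The default [u] is never taken when [f u <= r]. *)
pose relay u := odflt u [pick y | [&& e u y, y \in reach e f S v (f u) & f u < f y]].
have relayP u : f u <= r ->
    [/\ e u (relay u), relay u \in reach e f S v (f u) & f u < f (relay u)].
  move=> /rel /existsP[y hy]; rewrite /relay.
  by case: pickP => [z /and3P[]|/(_ y)]; rewrite ?hy.
have E z : decision e r out w z f S = out v0 (view e free z v0 r).
  rewrite (decision_failure_free sol adm fw hw relayP).
  by case: (sol z free (valid_failure_free e t r)) => agree _; apply: agree; rewrite inE ltnn.
rewrite -!E /decision !(view_reach _ _ (@represents_config _ e r _ _)).
congr (out w _); apply/ffunP=> u; rewrite !ffunE.
by case: eqVneq (xx' u) => [->|_ ->] //; rewrite (negbTE hw).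
Qed.

Theorem theorem1 (T : finType) (e : rel T) (I : Type) (t : nat) :
  symmetric e -> irreflexive e -> (forall x y : T, connect e x y) ->
  2 <= #|T| -> t < kappa e ->
  (exists a b : I, a <> b) ->
  forall (r : nat), lt_radius r (radius e t) ->
  forall out : T -> {ffun T -> option I} -> I,
    ~ oblivious_solves_consensus e t r out.
Proof.
move=> sym _ _ cT _ [a [b ab]] r rR out sol.
have /card_gt0P[v0 _] : 0 < #|T| by apply: leq_trans cT.
pose free := failure_free e r.
pose dec x := out v0 (view e free x v0 r).
(* Hybrid inputs lead from all [a] to all [b], one node at a time; [mix (enum T)] is constantly
   [b]. *)
pose mix (s : seq T) u := if u \in s then b else a.
have dec_mix s : dec (mix s) = dec (fun=> a).
  elim: s => [//|v s <-]; apply: (decision_independent (v := v)) sol rR _ => //.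
  by move=> u /negbTE uv; rewrite /mix inE uv.
have dec_const c x : (forall u, x u = c) -> dec x = c.
  move=> xc; case: (sol x free (valid_failure_free e t r)) => _ /(_ v0).
  by rewrite inE ltnn => /(_ isT)[u]; rewrite xc.
apply: ab; rewrite -(dec_const a (fun=> a)) // -(dec_mix (enum T)).
by apply: dec_const => u; rewrite /mix mem_enum.
Qed.
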